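(* Let $X,Y$ be Banach spaces over the same scalar field $\mathbb{K}\in\{\mathbb{R},\mathbb{C}\}$ and let $N$ be an absolute normalised norm on $\mathbb{R}^2$. Let $x\in S_X$, $y\in S_Y$ and let $a,b\geq 0$ be real numbers with $N(a,b)=1$. Suppose that $(ax,by)$ is a super $\Delta$-point in the absolute sum $X\oplus_N Y$. Then: (a) if $b\neq 1$, then $x$ is a super $\Delta$-point in $X$; (b) if $a\neq 1$, then $y$ is a super $\Delta$-point in $Y$; (c) if $a=b=1$, then $x$ is a super $\Delta$-point in $X$ or $y$ is a super $\Delta$-point in $Y$.
   Context: For a Banach space $X$, $B_X$ and $S_X$ denote the closed unit ball and the unit sphere of $X$. A point $x\in S_X$ is a super $\Delta$-point (in $X$) if for every relatively weakly open subset $W$ of $B_X$ with $x\in W$ and for every $\varepsilon>0$ there is some $y\in W$ such that $\|x-y\|\geq 2-\varepsilon$. An absolute normalised norm on $\mathbb{R}^2$ is a norm $N$ on $\mathbb{R}^2$ such that $N(a,b)=N(|a|,|b|)$ for all $(a,b)\in\mathbb{R}^2$ and $N(1,0)=N(0,1)=1$. Given Banach spaces $X,Y$ and such an $N$, the absolute sum $X\oplus_N Y$ is the product space $X\times Y$ endowed with the norm $\|(x,y)\|_N=N(\|x\|,\|y\|)$. *)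

(* Defs.v *)
From HB Require Import structures.
From mathcomp Require Import all_boot all_order all_algebra.
From mathcomp Require Import complex.
From mathcomp Require Import all_classical all_reals topology normedtype.
From mathcomp Require Import lra.

Set Implicit Arguments.
Unset Strict Implicit.
Unset Printing Implicit Defensive.

Import Order.TTheory GRing.Theory Num.Theory.
Import numFieldNormedType.Exports.

Local Open Scope classical_set_scope.
Local Open Scope ring_scope.

Definition dual (K : numFieldType) (X : normedModType K) : Type :=
  {f : {linear X -> K^o} | continuous f}.

Definition weak_topology (K : numFieldType) (X : normedModType K) :=
  sup_topology (fun f : dual X =>
    Topological.on (initial_topology (sval f : X -> K^o))).

Definition weakly_open (K : numFieldType) (X : normedModType K) (U : set X) :=
  open (U : set (weak_topology X)).

Definition unit_ball (K : numFieldType) (X : normedModType K) : set X :=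
  [set x | `|x| <= 1].

Definition unit_sphere (K : numFieldType) (X : normedModType K) : set X :=
  [set x | `|x| = 1].

Arguments unit_ball {K} X.
Arguments unit_sphere {K} X.

Definition rel_weakly_open_ball (K : numFieldType) (X : normedModType K)
    (W : set X) :=
  exists2 U : set X, weakly_open U & W = U `&` unit_ball X.

(* Over complex scalars, 0 < e forces e to be real, and 2 - e <= `|x - y|
   compares two real scalars. *)
Definition super_Delta_point (K : numFieldType) (X : completeNormedModType K)
    (x : X) :=
  unit_sphere X x /\
  forall W : set X, rel_weakly_open_ball W -> W x ->
    forall e : K, 0 < e -> exists2 y, W y & 2 - e <= `|x - y|.

Inductive scalar_kind := RealScalars | ComplexScalars.

Definition scalars (R : realType) (k : scalar_kind) : numFieldType :=
  match k with RealScalars => R | ComplexScalars => R[i] end.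

Definition of_real (R : realType) (k : scalar_kind) : R -> scalars R k :=
  match k with RealScalars => id | ComplexScalars => fun a => a%:C%C end.

(* The library norm of a normed module takes its values in the scalar field;
   on norms, which are nonnegative scalars, real_part is the inverse of
   of_real. *)
Definition real_part (R : realType) (k : scalar_kind) : scalars R k -> R :=
  match k with RealScalars => id | ComplexScalars => @complex.Re R end.

Section scalars_lemmas.
Variables (R : realType) (k : scalar_kind).
Implicit Types (a b : R) (z w : scalars R k).

Lemma of_realD : {morph @of_real R k : a b / a + b}.
Proof. by case: k => // a b; exact: rmorphD. Qed.

Lemma of_realM : {morph @of_real R k : a b / a * b}.
Proof. by case: k => // a b; exact: rmorphM. Qed.

Lemma of_real0 : of_real k (0 : R) = 0.
Proof. by case: k. Qed.

Lemma ler_of_real : {mono @of_real R k : a b / a <= b}.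
Proof. by case: k => // a b; rewrite /= lecR. Qed.

Lemma of_realK : cancel (@of_real R k) (@real_part R k).
Proof. by case: k. Qed.

Lemma real_partK z : 0 <= z -> of_real k (real_part z) = z.
Proof.
by case: k z => //= -[u v]; rewrite lecE /= => /andP[/eqP -> _].
Qed.

Lemma ge0_real_part z : 0 <= z -> 0 <= real_part z.
Proof. by move=> z0; rewrite -ler_of_real of_real0 real_partK. Qed.

Lemma real_partD z w : real_part (z + w) = real_part z + real_part w.
Proof. by case: k z w => //= -[? ?] [? ?]. Qed.

Lemma real_partM z w : 0 <= z -> 0 <= w ->
  real_part (z * w) = real_part z * real_part w.
Proof.
move=> z0 w0; rewrite -[in LHS](real_partK z0) -[in LHS](real_partK w0).
by rewrite -of_realM of_realK.
Qed.

Lemma ler_real_part z w : 0 <= z -> z <= w -> real_part z <= real_part w.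
Proof.
by move=> z0 zw; rewrite -ler_of_real !real_partK// (le_trans z0).
Qed.

End scalars_lemmas.

Record absolute_norm (R : realType) := AbsoluteNorm {
  absolute_norm_val :> R -> R -> R ;
  absolute_normD : forall a b c d,
    absolute_norm_val (a + c) (b + d) <=
    absolute_norm_val a b + absolute_norm_val c d ;
  absolute_normZ : forall l a b,
    absolute_norm_val (l * a) (l * b) = `|l| * absolute_norm_val a b ;
  absolute_norm_eq0 : forall a b,
    absolute_norm_val a b = 0 -> a = 0 /\ b = 0 ;
  absolute_norm_abs : forall a b,
    absolute_norm_val a b = absolute_norm_val `|a| `|b| ;
  absolute_norm10 : absolute_norm_val 1 0 = 1 ;
  absolute_norm01 : absolute_norm_val 0 1 = 1
}.

Section absolute_norm_lemmas.
Variables (R : realType) (N : absolute_norm R).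
Implicit Types a b c d l : R.

Lemma absolute_norm_ge0 a b : 0 <= N a b.
Proof.
have := absolute_normD N a b (- a) (- b).
rewrite (absolute_norm_abs N (- a)) !normrN -absolute_norm_abs !subrr.
have := absolute_normZ N 0 0 0; rewrite normr0 !mul0r => ->.
lra.
Qed.

Lemma ler_absolute_norml a c b : 0 <= a -> a <= c -> N a b <= N c b.
Proof.
move=> a0 ac; have [c0|c0] := eqVneq c 0; first by have -> : a = c by lra.
have {c0} c0 : 0 < c by rewrite lt_neqAle eq_sym c0 (le_trans a0 ac).
pose t := (1 + a / c) / 2.
have ac0 : 0 <= a / c by rewrite divr_ge0 // ltW.
have ac1 : a / c <= 1 by rewrite ler_pdivrMr // mul1r.
have E : a = t * c + (1 - t) * (- c).
  have := mulfVK (lt0r_neq0 c0) a; rewrite /t => h; lra.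
have E' : b = t * b + (1 - t) * b by lra.
rewrite {1}E {1}E'; apply: (le_trans (absolute_normD N _ _ _ _)).
rewrite !absolute_normZ (absolute_norm_abs N (- c)) normrN -absolute_norm_abs.
rewrite !ger0_norm; [lra|rewrite /t; lra|rewrite /t; lra].
Qed.

End absolute_norm_lemmas.

Definition absolute_norm_swap (R : realType) (N : absolute_norm R) :
  absolute_norm R.
Proof.
apply: (@AbsoluteNorm R (fun a b => N b a)).
- by move=> *; exact: absolute_normD.
- by move=> *; exact: absolute_normZ.
- by move=> a b /absolute_norm_eq0[].
- by move=> *; exact: absolute_norm_abs.
- exact: absolute_norm01.
- exact: absolute_norm10.
Defined.

Lemma ler_absolute_norm (R : realType) (N : absolute_norm R) (a b c d : R) :
  0 <= a -> a <= c -> 0 <= b -> b <= d -> N a b <= N c d.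
Proof.
move=> a0 ac b0 bd; apply: (le_trans (ler_absolute_norml N b a0 ac)).
exact: (ler_absolute_norml (absolute_norm_swap N) c b0 bd).
Qed.

(* An alias of X * Y, which carries the max norm in the library. *)
Definition absolute_sum (R : realType) (k : scalar_kind) (N : absolute_norm R)
  (X Y : normedModType (scalars R k)) : Type := (X * Y)%type.

Section absolute_sum_normed.
Variables (R : realType) (k : scalar_kind) (N : absolute_norm R).
Variables X Y : normedModType (scalars R k).
Implicit Types p q : absolute_sum N X Y.

HB.instance Definition _ :=
  GRing.Lmodule.copy (absolute_sum N X Y) (X * Y)%type.

Definition absolute_sum_norm (p : absolute_sum N X Y) : scalars R k :=
  of_real k (N (real_part `|p.1|) (real_part `|p.2|)).

Lemma ler_absolute_sum_normD p q :
  absolute_sum_norm (p + q) <= absolute_sum_norm p + absolute_sum_norm q.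
Proof.
rewrite -of_realD ler_of_real; apply: le_trans (absolute_normD N _ _ _ _).
by rewrite ler_absolute_norm ?ge0_real_part// -real_partD ler_real_part//
  ler_normD.
Qed.

Lemma absolute_sum_normZ (l : scalars R k) p :
  absolute_sum_norm (l *: p) = `|l| * absolute_sum_norm p.
Proof.
rewrite /absolute_sum_norm /= !normrZ !real_partM// absolute_normZ of_realM.
by rewrite (ger0_norm (ge0_real_part (normr_ge0 l))) real_partK.
Qed.

Lemma absolute_sum_norm_eq0 p : absolute_sum_norm p = 0 -> p = 0.
Proof.
rewrite -(of_real0 R k) => /(can_inj (@of_realK R k)) /absolute_norm_eq0[].
move=> /(congr1 (of_real k)); rewrite real_partK// of_real0 => /normr0_eq0 p1.
move=> /(congr1 (of_real k)); rewrite real_partK// of_real0 => /normr0_eq0 p2.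
by rewrite [p]surjective_pairing p1 p2.
Qed.

HB.instance Definition _ := @Lmodule_isNormed.Build (scalars R k)
  (absolute_sum N X Y) absolute_sum_norm
  ler_absolute_sum_normD absolute_sum_normZ absolute_sum_norm_eq0.

Lemma absolute_sum_normE (p : absolute_sum N X Y) :
  `|p| = of_real k (N (real_part `|p.1|) (real_part `|p.2|)).
Proof. by []. Qed.

End absolute_sum_normed.

Section absolute_sum_complete.
Variables (R : realType) (k : scalar_kind) (N : absolute_norm R).

Lemma ler_norm_absolute_sum1 (X Y : normedModType (scalars R k))
  (p : absolute_sum N X Y) : `|p.1| <= `|p|.
Proof.
rewrite -[leLHS]real_partK// [leRHS]/(of_real _ _) ler_of_real.
rewrite -[leLHS]mulr1 -(absolute_norm10 N).
rewrite -{1}(ger0_norm (ge0_real_part (normr_ge0 _))).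
rewrite -absolute_normZ mulr1 mulr0.
by rewrite ler_absolute_norm ?ge0_real_part.
Qed.

Lemma ler_norm_absolute_sum2 (X Y : normedModType (scalars R k))
  (p : absolute_sum N X Y) : `|p.2| <= `|p|.
Proof.
rewrite -[leLHS]real_partK// [leRHS]/(of_real _ _) ler_of_real.
rewrite -[leLHS]mulr1 -(absolute_norm01 N).
rewrite -{1}(ger0_norm (ge0_real_part (normr_ge0 _))).
rewrite -absolute_normZ mulr1 mulr0.
by rewrite ler_absolute_norm ?ge0_real_part.
Qed.

Lemma ler_absolute_sum_norm (X Y : normedModType (scalars R k))
  (p : absolute_sum N X Y) : `|p| <= `|p.1| + `|p.2|.
Proof.
rewrite -(real_partK (normr_ge0 p.1)) -(real_partK (normr_ge0 p.2)).
rewrite -of_realD [leLHS]/(of_real _ _) ler_of_real.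
set a := real_part `|p.1|; set b := real_part `|p.2|.
have a0 : 0 <= a by exact: ge0_real_part.
have b0 : 0 <= b by exact: ge0_real_part.
rewrite -[in leLHS](addr0 a) -[in leLHS](add0r b).
apply: (le_trans (absolute_normD N _ _ _ _)).
have := absolute_normZ N a 1 0; have := absolute_normZ N b 0 1.
by rewrite absolute_norm10 absolute_norm01 !mulr0 !mulr1 !ger0_norm// => -> ->.
Qed.

Variables X Y : completeNormedModType (scalars R k).

Lemma absolute_sum_complete (F : set_system (absolute_sum N X Y)) :
  ProperFilter F -> cauchy F -> cvg F.
Proof.
move=> FF Fc.
have Fb e : 0 < e -> exists p, F (ball p e) by move: e; exact/cauchyP.
have c1 : cvg ((fun p : absolute_sum N X Y => p.1 : X) @ F).
  apply: cauchy_cvg; apply/cauchyP => e /Fb[p Fp]; exists p.1.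
  suff s : ball p e `<=`
      (fun q : absolute_sum N X Y => q.1 : X) @^-1` ball p.1 e.
    exact: filterS s Fp.
  move=> q; rewrite /preimage/= -!ball_normE /= => pq; apply: le_lt_trans pq.
  exact: (ler_norm_absolute_sum1 (p - q)).
have c2 : cvg ((fun p : absolute_sum N X Y => p.2 : Y) @ F).
  apply: cauchy_cvg; apply/cauchyP => e /Fb[p Fp]; exists p.2.
  suff s : ball p e `<=`
      (fun q : absolute_sum N X Y => q.2 : Y) @^-1` ball p.2 e.
    exact: filterS s Fp.
  move=> q; rewrite /preimage/= -!ball_normE /= => pq; apply: le_lt_trans pq.
  exact: (ler_norm_absolute_sum2 (p - q)).
apply/cvg_ex.
exists ((lim ((fun p : absolute_sum N X Y => p.1 : X) @ F),
         lim ((fun p : absolute_sum N X Y => p.2 : Y) @ F))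
         : absolute_sum N X Y).
apply/cvgrPdist_lt => e e0; near=> p.
apply: (le_lt_trans (ler_absolute_sum_norm _)) => /=.
rewrite (splitr e) ltrD//; near: p.
- by move/cvgrPdist_lt : c1; apply; rewrite divr_gt0.
- by move/cvgrPdist_lt : c2; apply; rewrite divr_gt0.
Unshelve. all: by end_near. Qed.

HB.instance Definition _ :=
  Uniform_isComplete.Build (absolute_sum N X Y) absolute_sum_complete.

End absolute_sum_complete.

(* Main.v *)
Require Import Defs.
From HB Require Import structures.
From mathcomp Require Import all_boot all_order all_algebra.
From mathcomp Require Import complex.
From mathcomp Require Import all_classical all_reals topology normedtype.
From mathcomp Require Import ring lra.

(** Why the theorem holds.

    Take [b <> 1], hence [b < 1] and [0 < a].  A relatively weakly open subset
    of the unit ball of the sum around [(a x, b y)] may be shrunk so that its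
    points [(u, v)] have [a^-1 u] weakly close to [x] and, because norms are
    weakly lower semicontinuous, [`|u|] and [`|v|] almost at least [a] and [b].
    Convexity of [N] along horizontal segments does the rest
    ([absolute_norm_near_extremal]).  As [N 0 b = b < 1 = N a b], the function
    [N (-) b] increases strictly from [a] on, so [N `|u| `|v| <= 1] forces
    [`|u|] to be at most about [a].  If moreover the distance from [(u, v)] to
    [(a x, b y)] is almost [2], the same convexity at height [b + `|v|], where
    [N 0 (b + `|v|) <= 1 + b < 2], forces [`|a x - u|] to be almost
    [a + `|u|], thus almost [2 a].  Dividing [u] by [Num.max a `|u|] gives a
    point of the unit ball of [X], weakly close to [x] and almost at distance
    [2] from it ([super_Delta_fst]).

    The other coordinate follows because exchanging the coordinates is a linear
    isometry onto the sum for the swapped norm, and linear isometries preserve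
    super Delta-points.  If [a = b = 1] then [N 1 1 = 1] makes [N] at most the
    maximum norm; were neither coordinate a super Delta-point, the product of
    two witnessing weakly open sets would contradict the hypothesis.

    Weak lower semicontinuity of the norm rests on the Hahn-Banach theorem over
    both scalar fields.  It is obtained by showing that a minimal sublinear
    functional is linear: Zorn's lemma is applied to functionals defined on the
    whole space, and linearity replaces the usual one-dimensional extension. *)

Set Implicit Arguments.
Unset Strict Implicit.
Unset Printing Implicit Defensive.

Import Order.TTheory GRing.Theory Num.Theory.
Import numFieldNormedType.Exports.

Local Open Scope classical_set_scope.
Local Open Scope ring_scope.

(** * Real numbers inside the scalars *)

Section of_real_lemmas.
Variables (R : realType) (k : scalar_kind).
Implicit Types a b t : R.

Lemma of_real1 : of_real k (1 : R) = 1.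
Proof. by case: k. Qed.

Lemma of_realN a : of_real k (- a) = - of_real k a.
Proof. by case: k => //=; rewrite rmorphN. Qed.

Lemma of_realB a b : of_real k (a - b) = of_real k a - of_real k b.
Proof. by rewrite of_realD of_realN. Qed.

Lemma ltr_of_real : {mono @of_real R k : a b / a < b}.
Proof. by case: k => // a b; rewrite /= ltcR. Qed.

Lemma normr_of_real a : `|of_real k a| = of_real k `|a|.
Proof.
by case: k => //=; rewrite normc_def /= expr0n addr0 sqrtr_sqr.
Qed.

Lemma real_part_norm_ge (z : scalars R k) : - real_part `|z| <= real_part z.
Proof.
suff : `|real_part z| <= real_part `|z| by rewrite ler_norml => /andP[].
by case: k z => //= z; rewrite -lecR (le_trans (normc_ge_Re z))// real_partK.
Qed.

End of_real_lemmas.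

(** * Hahn-Banach extension *)

Section hahn_banach.
Variables (R : realType) (k : scalar_kind) (X : lmodType (scalars R k)).
Local Notation "t ** x" := (of_real k t *: x) (at level 40).
Implicit Types (p q : X -> R) (u v x y z : X) (s t : R).

Definition sublinear p :=
  (forall u v, p (u + v) <= p u + p v) /\
  (forall t u, 0 <= t -> p (t ** u) <= t * p u).

Lemma sublinear0 p : sublinear p -> p 0 = 0.
Proof.
move=> [pD pZ]; have := pZ 0 0 (lexx 0); have := pD 0 0.
by rewrite scaler0 addr0 mul0r; lra.
Qed.

Lemma sublinear_ge p u : sublinear p -> - p (- u) <= p u.
Proof.
by move=> sp; have := sp.1 u (- u); rewrite subrr sublinear0//; lra.
Qed.

Lemma sublinearZ p t u : sublinear p -> 0 <= t -> p (t ** u) = t * p u.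
Proof.
move=> sp; rewrite le_eqVlt => /orP[/eqP<-|t0].
  by rewrite of_real0 scale0r sublinear0// mul0r.
apply/eqP; rewrite eq_le; apply/andP; split; first exact/sp.2/ltW.
rewrite -ler_pdivlMl//.
have := sp.2 t^-1 (t ** u); rewrite scalerA -of_realM mulVf ?gt_eqF//.
by rewrite of_real1 scale1r; apply; rewrite invr_ge0 ltW.
Qed.

(** The largest sublinear functional [r] below [q] such that
    [r (- y) = - q y], that is, which is linear on the line through [y].  If [q]
    is minimal then [tilt q y] equals [q] for every [y], and [q] is linear. *)
Definition tilt q y x : R :=
  inf [set q (x + t ** y) - t * q y | t in [set t | 0 <= t]].

Lemma ge_tilt q y x c : (forall t, 0 <= t -> c <= q (x + t ** y) - t * q y) ->
  c <= tilt q y x.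
Proof.
move=> cle; apply: lb_le_inf; last by move=> _ [t t0 <-]; exact: cle.
by exists (q (x + 0 ** y) - 0 * q y); exists 0 => /=.
Qed.

Lemma tilt_le q y x t : sublinear q -> 0 <= t ->
  tilt q y x <= q (x + t ** y) - t * q y.
Proof.
move=> sq t0; apply: ge_inf; last by exists t.
exists (- q (- x)) => _ [s /= s0 <-].
have := sq.1 (x + s ** y) (- x).
by rewrite addrAC subrr add0r sublinearZ//; lra.
Qed.

Lemma tilt_le_self q y x : sublinear q -> tilt q y x <= q x.
Proof.
move=> sq; have := tilt_le y x sq (lexx 0).
by rewrite of_real0 scale0r addr0 mul0r subr0.
Qed.

Lemma sublinear_tilt q y : sublinear q -> sublinear (tilt q y).
Proof.
move=> sq; split=> [u v|s u s0].
  rewrite -lerBlDr; apply: ge_tilt => t t0; rewrite lerBlDl -lerBlDr.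
  apply: ge_tilt => s s0.
  have := tilt_le y (u + v) sq (addr_ge0 t0 s0).
  have := sq.1 (u + t ** y) (v + s ** y).
  rewrite addrACA -scalerDl -of_realD; lra.
have : forall t, 0 <= t -> tilt q y (s ** u) <= s * (q (u + t ** y) - t * q y).
  move=> t t0; apply: (le_trans (tilt_le y _ sq (mulr_ge0 s0 t0))).
  by rewrite of_realM -scalerA -scalerDr sublinearZ// mulrBr mulrA.
move: s0; rewrite le_eqVlt => /orP[/eqP<- /(_ 0 (lexx 0))|s0 H].
  by rewrite !mul0r.
rewrite -ler_pdivrMl//; apply: ge_tilt => t t0.
by rewrite ler_pdivrMl// H.
Qed.

(** Zorn's lemma: a chain of sublinear functionals below [p] is bounded below
    by its pointwise infimum, which is finite because every [q] in it satisfies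
    [- p (- u) <= q u]. *)
Lemma exists_minimal_sublinear p : sublinear p ->
  exists q, [/\ sublinear q, forall u, q u <= p u &
    forall q', sublinear q' -> (forall u, q' u <= q u) ->
      forall u, q u <= q' u].
Proof.
move=> sp; pose T := {q | sublinear q /\ forall u, q u <= p u}.
pose ge (q r : T) := `[< forall u, sval r u <= sval q u >].
have [||A Atot|[q [sq qp]] qmin] :=
  @ZL_preorder T (exist _ p (conj sp (fun u => lexx (p u)))) ge.
- by move=> q; apply/asboolP.
- move=> q r s /asboolP rq /asboolP qs; apply/asboolP => u.
  exact: le_trans (qs u) (rq u).
- have [->|/set0P[q0 Aq0]] := eqVneq A set0.
    by exists (exist _ p (conj sp (fun u => lexx (p u)))).
  pose m u := inf [set sval q u | q in A].
  have m_le (q : T) u : A q -> m u <= sval q u.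
    move=> Aq; apply: ge_inf; last by exists q.
    exists (- p (- u)) => _ [r _ <-].
    have [sr rp] := svalP r; apply: le_trans (sublinear_ge u sr).
    by rewrite lerN2.
  have m_ge u c : (forall q : T, A q -> c <= sval q u) -> c <= m u.
    move=> cle; apply: lb_le_inf; first by exists (sval q0 u); exists q0.
    by move=> _ [q Aq <-]; exact: cle.
  have sm : sublinear m.
    split=> [u v|t u]; last first.
      rewrite le_eqVlt => /orP[/eqP<-|t0].
        rewrite mul0r of_real0 scale0r; apply: (le_trans (m_le q0 _ Aq0)).
        by rewrite sublinear0//; case: (svalP q0).
      rewrite -ler_pdivrMl//; apply: m_ge => q Aq; rewrite ler_pdivrMl//.
      apply: (le_trans (m_le q _ Aq)).
      by have [[_ +] _] := svalP q; apply; exact: ltW.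
    rewrite -lerBlDr; apply: (m_ge) => q Aq; rewrite lerBlDl -lerBlDr.
    apply: m_ge => r Ar; rewrite lerBlDl.
    have [/asboolP|/asboolP] := Atot _ _ Aq Ar => qr.
      apply: (le_trans (m_le r _ Ar)); have [[rD _] _] := svalP r.
      by apply: (le_trans (rD _ _)); rewrite lerD2r.
    apply: (le_trans (m_le q _ Aq)); have [[qD _] _] := svalP q.
    by apply: (le_trans (qD _ _)); rewrite lerD2l.
  have mp u : m u <= p u.
    by apply: (le_trans (m_le q0 _ Aq0)); have [_] := svalP q0; apply.
  by exists (exist _ m (conj sm mp)) => q Aq; apply/asboolP => u; exact: m_le.
exists q; split=> // q' sq' q'q.
have q'p u : q' u <= p u by exact: le_trans (q'q u) (qp u).
suff /asboolP : ge (exist _ q' (conj sq' q'p)) (exist _ q (conj sq qp)) by [].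
by apply: qmin; exact/asboolP.
Qed.

Definition real_linear (g : X -> R) :=
  (forall u v, g (u + v) = g u + g v) /\ (forall t u, g (t ** u) = t * g u).

Lemma real_linearN (g : X -> R) u : real_linear g -> g (- u) = - g u.
Proof.
by move=> [_ gZ]; have := gZ (-1) u; rewrite of_realN of_real1 scaleN1r mulN1r.
Qed.

(** Minimality gives [g u <= tilt g v u <= g (u + v) - g v], the inequality
    opposite to subadditivity. *)
Lemma exists_real_linear_le p : sublinear p ->
  exists2 g, real_linear g & forall u, g u <= p u.
Proof.
move=> /exists_minimal_sublinear[g [sg gp gmin]]; exists g => //.
have gD u v : g (u + v) = g u + g v.
  apply/eqP; rewrite eq_le sg.1 /=.
  have := gmin _ (sublinear_tilt v sg) (fun w => tilt_le_self v w sg) u.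
  have := tilt_le v u sg ler01.
  by rewrite of_real1 scale1r; lra.
have gN u : g (- u) = - g u.
  by have := gD u (- u); rewrite subrr sublinear0//; lra.
split=> // t u; have [t0|/ltW t0] := leP 0 t; first exact: sublinearZ.
rewrite -[t]opprK of_realN scaleNr gN sublinearZ ?oppr_ge0//.
by rewrite !mulNr.
Qed.

(** Dominating [g] by [tilt p z] instead of [p] makes [g] touch [p] at [z],
    because [tilt p z (- z) <= - p z]. *)
Theorem hahn_banach_touching p z : sublinear p ->
  exists g, [/\ real_linear g, forall u, g u <= p u & g z = p z].
Proof.
move=> sp; have [g lg gt] := exists_real_linear_le (sublinear_tilt z sp).
have gp u : g u <= p u by exact: le_trans (gt u) (tilt_le_self z u sp).
exists g; split=> //; apply/eqP; rewrite eq_le gp /=.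
have := gt (- z); have := tilt_le z (- z) sp ler01.
rewrite of_real1 scale1r addNr sublinear0// (real_linearN z lg); lra.
Qed.

End hahn_banach.

(** * Real-valued norms and the weak topology *)

Section real_norm.
Variables (R : realType) (k : scalar_kind) (X : normedModType (scalars R k)).
Implicit Types (u v : X) (t : R).

Definition real_norm u : R := real_part `|u|.

Lemma of_real_norm u : of_real k (real_norm u) = `|u|.
Proof. exact: real_partK. Qed.

Lemma real_norm_ge0 u : 0 <= real_norm u.
Proof. exact: ge0_real_part. Qed.

Lemma ler_real_normD u v : real_norm (u + v) <= real_norm u + real_norm v.
Proof. by rewrite -real_partD ler_real_part// ler_normD. Qed.

Lemma real_normN u : real_norm (- u) = real_norm u.
Proof. by rewrite /real_norm normrN. Qed.

Lemma ler_real_normB u v : real_norm (u - v) <= real_norm u + real_norm v.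
Proof. by rewrite -(real_normN v) ler_real_normD. Qed.

Lemma real_normZ t u : real_norm (of_real k t *: u) = `|t| * real_norm u.
Proof. by rewrite /real_norm normrZ real_partM// normr_of_real of_realK. Qed.

Lemma unit_sphereE u : unit_sphere X u <-> real_norm u = 1.
Proof.
rewrite /unit_sphere /= -of_real_norm -(of_real1 R k).
by split=> [/(can_inj (@of_realK R k))|->].
Qed.

Lemma unit_ballE u : unit_ball X u <-> real_norm u <= 1.
Proof. by rewrite /unit_ball /= -of_real_norm -(of_real1 R k) ler_of_real. Qed.

Lemma sublinear_real_norm : sublinear real_norm.
Proof.
split=> [u v|t u t0]; first exact: ler_real_normD.
by rewrite real_normZ ger0_norm.
Qed.

End real_norm.

Lemma le_norm_continuous (K : numFieldType) (X Y : normedModType K)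
    (T : {linear X -> Y}) (C : K) :
  (forall u, `|T u| <= C * `|u|) -> continuous T.
Proof.
move=> TC; apply/bounded_linear_continuous/linear_boundedP.
exists `|C|; split=> [|r Cr u]; first exact: normr_real.
have [->|u0] := eqVneq u 0; first by rewrite linear0 !normr0 mulr0.
have u_gt0 : 0 < `|u| by rewrite normr_gt0.
have TuC := TC u; have C0 : 0 <= C.
  by rewrite -(pmulr_lge0 _ u_gt0); exact: (le_trans (normr_ge0 _) TuC).
apply: (le_trans TuC); rewrite ler_pM2r//; apply: ltW.
by rewrite -(ger0_norm C0).
Qed.

(** Over complex scalars a functional is determined by its real part [g]: it
    has to be [u |-> g u - i g (i u)]. *)
Lemma real_linear_dual (R : realType) (k : scalar_kind)
    (X : normedModType (scalars R k)) (g : X -> R) :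
  real_linear g -> (forall u, g u <= real_norm u) ->
  exists f : dual X, forall u, real_part (sval f u) = g u.
Proof.
move=> lg gle; have {gle} gle u : `|g u| <= real_norm u.
  by rewrite ler_norml gle andbT lerNl -(real_linearN u lg) -(real_normN u) gle.
case: k X g lg gle => /= X g [gD gZ] gle.
  have lin_g : linear (g : X -> R^o) by move=> t u v; rewrite gD gZ.
  pose f : {linear X -> R^o} := HB.pack (g : X -> R^o)
    (GRing.isLinear.Build _ _ _ _ (g : X -> R^o) lin_g).
  have cf : continuous f.
    by apply: (@le_norm_continuous _ _ _ f 1) => u; rewrite mul1r; exact: gle.
  by exists (exist _ f cf).
pose F (u : X) : R[i]^o := (g u +i* - g ('i%C *: u))%C.
have lin_F : linear F.
  move=> [s t] u v; rewrite /F.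
  have E w : (s +i* t)%C *: w = s%:C%C *: w + t%:C%C *: ('i%C *: w).
    rewrite scalerA -scalerDl; congr (_ *: _).
    by apply/eqP; rewrite eq_complex /=; apply/andP; split; apply/eqP; ring.
  have Ei w : 'i%C *: ((s +i* t)%C *: w) =
      s%:C%C *: ('i%C *: w) + (- t)%:C%C *: w.
    rewrite !scalerA -scalerDl; congr (_ *: _).
    by apply/eqP; rewrite eq_complex /=; apply/andP; split; apply/eqP; ring.
  rewrite scalerDr Ei E !gD !gZ.
  by apply/eqP; rewrite eq_complex /=; apply/andP; split; apply/eqP; ring.
pose f : {linear X -> R[i]^o} := HB.pack F
  (GRing.isLinear.Build _ _ _ _ F lin_F).
have cf : continuous f.
  apply: (@le_norm_continuous _ _ _ f 2) => u.
  have -> : f u = (g u)%:C%C - 'i%C * (g ('i%C *: u))%:C%C.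
    by apply/eqP; rewrite eq_complex /=; apply/andP; split; apply/eqP; ring.
  apply: (le_trans (ler_normB _ _)); rewrite normrM.
  have i1 : `|'i%C : R[i]| = 1.
    by rewrite normc_def /= expr0n expr1n add0r sqrtr1.
  rewrite i1 mul1r mulr2n mulrDl mul1r.
  have H w : `|(g w)%:C%C| <= `|w|.
    rewrite -(@of_real_norm R ComplexScalars X w) normc_def /= expr0n addr0.
    by rewrite sqrtr_sqr lecR; exact: gle.
  by apply: lerD (H u) _; rewrite (le_trans (H _))// normrZ i1 mul1r.
by exists (exist _ f cf).
Qed.

Lemma exists_norming_functional (R : realType) (k : scalar_kind)
    (X : normedModType (scalars R k)) (x : X) :
  exists f : dual X, real_part (sval f x) = real_norm x /\
    forall u, real_part (sval f u) <= real_norm u.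
Proof.
have [g [lg gle gx]] := hahn_banach_touching x (sublinear_real_norm X).
have [f fg] := real_linear_dual lg gle.
by exists f; split=> [|u]; rewrite fg.
Qed.

Section weak_topology.
Variables (K : numFieldType) (X : normedModType K).

Lemma weakly_openI (U V : set X) :
  weakly_open U -> weakly_open V -> weakly_open (U `&` V).
Proof. exact: openI. Qed.

Lemma dual_weak_continuous (f : dual X) :
  continuous (sval f : weak_topology X -> K^o).
Proof.
move=> x.
have := (@cvg_sup _ _ _ (nbhs (x : weak_topology X)) x _).1 (fun=> id) f.
move=> nx; apply: cvg_trans (@initial_continuous _ _ (sval f) x).
by move=> A /= /nx.
Qed.

Lemma cvg_weak (F : set_system X) (x : X) : Filter F ->
  (forall f : dual X, sval f @ F --> sval f x) -> F --> (x : weak_topology X).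
Proof.
move=> FF fF; apply/cvg_sup => f A /= [_ [[B oB <-] Bfx BA]].
by apply: filterS BA _; apply: fF; exact: open_nbhs_nbhs.
Qed.

(** Joint continuity of the scalar multiplication for the weak topology: each
    functional turns it into the multiplication of scalars. *)
Lemma weakly_open_scale (U : set X) (c : K) (z : X) :
  weakly_open U -> U (c *: z) ->
  exists2 d : K, 0 < d & exists V : set X, [/\ weakly_open V, V z &
    forall l u, `|c - l| < d -> V u -> U (l *: u)].
Proof.
move=> oU Ucz.
pose F := filter_prod (nbhs (c : K^o)) (nbhs (z : weak_topology X)).
have scale_cvg : (fun p : K * X => p.1 *: p.2) @ F -->
    (c *: z : weak_topology X).
  apply: cvg_weak => f.
  suff : sval f \o (fun p : K * X => p.1 *: p.2) @ F --> sval f (c *: z) by [].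
  have -> : sval f \o (fun p : K * X => p.1 *: p.2) =
      (fun p : K * X => p.1 *: sval f p.2).
    by apply/funext => p /=; rewrite linearZ.
  rewrite linearZ /=.
  apply: (@cvgZ K K^o _ F _ fst (fun p : K * X => sval f p.2) c (sval f z)).
    exact: cvg_fst.
  apply: cvg_comp; first exact: cvg_snd.
  exact: dual_weak_continuous.
have /scale_cvg[[A V] /= [/nbhs_ballP[d /= d0 dA]]] :
    nbhs (c *: z : weak_topology X) U by exact: open_nbhs_nbhs.
rewrite nbhsE => -[W [oW Wz] WV] AVU.
exists d => //; exists W; split=> // l u cl Wu.
by apply: (AVU (l, u)); split; [apply: dA|exact: WV].
Qed.

End weak_topology.

(** Precomposition with [T] sends the dual of [Y] to the dual of [X]. *)
Lemma weakly_open_preimage (K : numFieldType) (X Y : normedModType K)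
    (T : {linear X -> Y}) (U : set Y) :
  continuous T -> weakly_open U -> weakly_open (T @^-1` U).
Proof.
move=> cT oU; rewrite /weakly_open.
apply: (@open_comp (weak_topology X) (weak_topology Y)) => // x _.
apply: (@cvg_weak _ _ (T @ nbhs (x : weak_topology X))) => f.
have cfT : continuous (sval f \o T : X -> K^o).
  by move=> u; apply: continuous_comp; [exact: cT|exact: (svalP f)].
exact: (@dual_weak_continuous _ _
  (exist _ (sval f \o T : {linear X -> K^o}) cfT)).
Qed.

(** Weak lower semicontinuity of the norm: it is bounded below by the real part
    of a functional that attains it at [x]. *)
Lemma weakly_open_norm_gt (R : realType) (k : scalar_kind)
    (X : normedModType (scalars R k)) (x : X) (h : R) : 0 < h ->
  exists U : set X, [/\ weakly_open U, U x &
    forall u, U u -> real_norm x - h < real_norm u].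
Proof.
move=> h0; have [f [fx fle]] := exists_norming_functional x.
have h0' : 0 < of_real k h by rewrite -(of_real0 R k) ltr_of_real.
exists (sval f @^-1` ball (sval f x : (scalars R k)^o) (of_real k h)); split.
- apply: (@open_comp (weak_topology X)) => [u _|].
    exact: dual_weak_continuous.
  exact: ball_open.
- exact: ballxx.
- move=> u; rewrite /= -ball_normE /= distrC.
  set w := _ - _ => fu.
  have {}fu : real_part `|w| < h by rewrite -(ltr_of_real k) real_partK.
  have fE : real_part (sval f u) = real_part w + real_part (sval f x).
    by rewrite -real_partD subrK.
  have := real_part_norm_ge w; have := fle u; lra.
Qed.

(** * Geometry of absolute norms *)

Section absolute_norm_geometry.
Variables (R : realType) (N : absolute_norm R).
Implicit Types a b p q r t m h l D : R.

Lemma absolute_norm0l b : 0 <= b -> N 0 b = b.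
Proof.
move=> b0; have := absolute_normZ N b 0 1.
by rewrite mulr0 mulr1 absolute_norm01 mulr1 ger0_norm.
Qed.

Lemma absolute_norm_ge_r a b : 0 <= a -> 0 <= b -> b <= N a b.
Proof. by move=> a0 b0; rewrite -{1}(absolute_norm0l b0) ler_absolute_norm. Qed.

Lemma absolute_norm_ge_l a b : 0 <= a -> 0 <= b -> a <= N a b.
Proof.
move=> a0 b0; have := absolute_normZ N a 1 0.
rewrite mulr0 mulr1 absolute_norm10 mulr1 ger0_norm// => {1}<-.
by rewrite ler_absolute_norm.
Qed.

(** Convexity on the horizontal segment from [(0, m)] to [(p, m)]. *)
Lemma absolute_norm_convex p m l : 0 <= l -> l <= 1 -> 0 <= m ->
  N (l * p) m <= l * N p m + (1 - l) * m.
Proof.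
move=> l0 l1 m0; have l1' : 0 <= 1 - l by lra.
have := absolute_normD N (l * p) (l * m) 0 ((1 - l) * m).
rewrite absolute_normZ ger0_norm// (absolute_norm0l (mulr_ge0 l1' m0)).
by rewrite addr0 -mulrDl addrC subrK mul1r.
Qed.

(** The geometric core.  Think of [p, q, r, t] as the norms of
    [u, v, a x - u, b y - v].  The norm [N] may have flat parts, but on the
    horizontal lines at heights [b] and [b + q] its values on the vertical axis,
    [b] and [b + q <= 1 + b], lie at least [1 - b] below the values [1] and [2]
    that it has nearly to reach.  This slope turns an error [D * (1 - b)] in the
    hypotheses into a horizontal error of order [D]. *)
Lemma absolute_norm_near_extremal a b p q r t D :
  0 < a -> 0 <= b -> b < 1 -> N a b = 1 -> 0 < D ->
  a - D * (1 - b) <= p -> b - D * (1 - b) <= q -> 0 <= p -> 0 <= q ->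
  N p q <= 1 -> 0 <= r -> r <= a + p -> 0 <= t -> t <= b + q ->
  2 - D * (1 - b) <= N r t ->
  p <= a + D /\ 2 * a - 3 * D <= r.
Proof.
move=> a0 b0 b1 Nab D0 ap bq p0 q0 Npq r0 rap t0 tbq Nrt.
have b1' : 0 < 1 - b by lra.
have a1 : a <= 1 by rewrite -Nab absolute_norm_ge_l// ltW.
have p1 : p <= 1 by apply: le_trans Npq; exact: absolute_norm_ge_l.
have q1 : q <= 1 by apply: le_trans Npq; exact: absolute_norm_ge_r.
have hD : 0 < D * (1 - b) by rewrite mulr_gt0.
have s0 : 0 < a + p by lra.
split.
  (* [a] is the fraction [a / p] of [p]: compare [N] at [0], [a] and [p]. *)
- have [|ltap] := leP p a; first by lra.
  have p_gt0 : 0 < p by lra.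
  have Npb : N p b <= 1 + D * (1 - b).
    apply: (@le_trans _ _ (N (p + 0) (q + D * (1 - b)))).
      by rewrite addr0; apply: ler_absolute_norm => //; lra.
    apply: (le_trans (absolute_normD N _ _ _ _)).
    by rewrite (absolute_norm0l (ltW hD)); lra.
  have lp : a / p * p = a by rewrite divfK// gt_eqF.
  have l1 : a / p <= 1 by rewrite ler_pdivrMr// mul1r ltW.
  have := absolute_norm_convex p (ltW (divr_gt0 a0 p_gt0)) l1 b0.
  rewrite lp Nab; set l := a / p in lp l1 * => conv.
  have l0 : 0 < l by rewrite divr_gt0.
  have : (1 - l) * (1 - b) <= l * D * (1 - b) by nra.
  rewrite ler_pM2r// => H.
  nra.
  (* [r] is the fraction [r / (a + p)] of its largest possible value [a + p],
     where [N (a + p) (b + q) <= N a b + N p q <= 2]. *)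
- have lp : r / (a + p) * (a + p) = r by rewrite divfK// gt_eqF.
  have l1 : r / (a + p) <= 1 by rewrite ler_pdivrMr// mul1r.
  have l0 : 0 <= r / (a + p) by rewrite divr_ge0// ltW.
  have := absolute_norm_convex (a + p) l0 l1 (addr_ge0 b0 q0).
  rewrite lp; set l := r / (a + p) in lp l1 l0 * => conv.
  have := ler_absolute_norm N r0 (lexx r) t0 tbq.
  have := absolute_normD N a b p q; rewrite Nab => Nsum Ntbq.
  have : (1 - l) * (1 - b) <= D * (1 - b) by nra.
  rewrite ler_pM2r// => lD.
  nra.
Qed.

Lemma absolute_norm_le_max r t : N 1 1 = 1 -> 0 <= r -> 0 <= t ->
  N r t <= Num.max r t.
Proof.
move=> N11 r0 t0; have := absolute_normZ N (Num.max r t) 1 1.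
rewrite N11 !mulr1 ger0_norm; last by rewrite le_max r0.
by move=> <-; rewrite ler_absolute_norm ?le_max ?lexx ?orbT.
Qed.

End absolute_norm_geometry.

(** * Absolute sums and super Delta-points *)

Section absolute_sum_maps.
Variables (R : realType) (k : scalar_kind) (N : absolute_norm R).
Variables X Y : normedModType (scalars R k).
Implicit Types p : absolute_sum N X Y.

Lemma real_norm_absolute_sum p :
  real_norm p = N (real_norm p.1) (real_norm p.2).
Proof. by rewrite /real_norm absolute_sum_normE of_realK. Qed.

Definition absolute_sum_fst p : X := p.1.

Lemma absolute_sum_fst_linear : linear absolute_sum_fst.
Proof. by []. Qed.

HB.instance Definition _ := GRing.isLinear.Build (scalars R k)
  (absolute_sum N X Y) X *:%R absolute_sum_fst absolute_sum_fst_linear.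

Lemma absolute_sum_fst_continuous : continuous absolute_sum_fst.
Proof.
apply: (@le_norm_continuous _ _ _ absolute_sum_fst 1) => p.
by rewrite mul1r ler_norm_absolute_sum1.
Qed.

Definition absolute_sum_snd p : Y := p.2.

Lemma absolute_sum_snd_linear : linear absolute_sum_snd.
Proof. by []. Qed.

HB.instance Definition _ := GRing.isLinear.Build (scalars R k)
  (absolute_sum N X Y) Y *:%R absolute_sum_snd absolute_sum_snd_linear.

Lemma absolute_sum_snd_continuous : continuous absolute_sum_snd.
Proof.
apply: (@le_norm_continuous _ _ _ absolute_sum_snd 1) => p.
by rewrite mul1r ler_norm_absolute_sum2.
Qed.

Lemma weakly_open_setX (U : set X) (V : set Y) :
  weakly_open U -> weakly_open V ->
  weakly_open ([set p | U p.1 /\ V p.2] : set (absolute_sum N X Y)).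
Proof.
move=> oU oV.
have oU' := weakly_open_preimage absolute_sum_fst_continuous oU.
have oV' := weakly_open_preimage absolute_sum_snd_continuous oV.
exact: (weakly_openI oU' oV').
Qed.

Definition absolute_sum_swap p : absolute_sum (absolute_norm_swap N) Y X :=
  (p.2, p.1).

Lemma absolute_sum_swap_linear : linear absolute_sum_swap.
Proof. by []. Qed.

HB.instance Definition _ := GRing.isLinear.Build (scalars R k)
  (absolute_sum N X Y) (absolute_sum (absolute_norm_swap N) Y X) *:%R
  absolute_sum_swap absolute_sum_swap_linear.

End absolute_sum_maps.

Section super_Delta.
Variables (R : realType) (k : scalar_kind).

(** Moves the estimates to [R], where the order is total also when the scalars
    are complex. *)
Lemma super_DeltaP (X : completeNormedModType (scalars R k)) (x : X) :
  super_Delta_point x <->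
  real_norm x = 1 /\ forall U : set X, weakly_open U -> U x ->
    forall e : R, 0 < e ->
      exists y, [/\ U y, real_norm y <= 1 & 2 - e <= real_norm (x - y)].
Proof.
have two_sub e y : (2 - of_real k e <= `|x - y|) = (2 - e <= real_norm (x - y)).
  rewrite -(ler_of_real k) of_real_norm of_realB.
  by rewrite -[2]/(1 + 1) -[2 in RHS]/(1 + 1) of_realD of_real1.
split=> [[/unit_sphereE x1 xW]|[x1 xU]].
  split=> // U oU Ux e e0.
  have oW : rel_weakly_open_ball (U `&` unit_ball X) by exists U.
  have Wx : (U `&` unit_ball X) x by split=> //; apply/unit_ballE; rewrite x1.
  have [|y [Uy /unit_ballE y1] xy] := xW _ oW Wx (of_real k e).
    by rewrite -(of_real0 R k) ltr_of_real.
  by exists y; split=> //; rewrite -two_sub.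
split; first exact/unit_sphereE.
move=> _ [U oU ->] [Ux _] e e0.
have eE : of_real k (real_part e) = e by rewrite real_partK// ltW.
have [|y [Uy y1 xy]] := xU U oU Ux (real_part e).
  by rewrite -(ltr_of_real k) eE of_real0.
by exists y; [split=> //; exact/unit_ballE|rewrite -eE two_sub].
Qed.

Lemma not_super_DeltaP (X : completeNormedModType (scalars R k)) (x : X) :
  unit_sphere X x -> ~ super_Delta_point x ->
  exists U : set X, [/\ weakly_open U, U x & exists2 e : R, 0 < e &
    forall u, U u -> real_norm u <= 1 -> real_norm (x - u) < 2 - e].
Proof.
move=> /unit_sphereE x1 nx; apply: contrapT => nU; apply: nx.
apply/super_DeltaP; split=> // U oU Ux e e0.
apply: contrapT => nu; apply: nU; exists U; split=> //.
exists e => // u Uu u1; rewrite ltNge; apply/negP => xu.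
by apply: nu; exists u.
Qed.

Lemma super_Delta_isometry (X Y : completeNormedModType (scalars R k))
    (T : {linear X -> Y}) (x : X) :
  (forall u, `|T u| = `|u|) -> super_Delta_point x -> super_Delta_point (T x).
Proof.
move=> iT /super_DeltaP[x1 xU].
have rT u : real_norm (T u) = real_norm u by rewrite /real_norm iT.
apply/super_DeltaP; split=> [|U oU UTx e e0]; first by rewrite rT.
have cT : continuous T.
  by apply: (@le_norm_continuous _ _ _ T 1) => u; rewrite mul1r iT.
have [y [Uy y1 xy]] := xU _ (weakly_open_preimage cT oU) UTx e e0.
by exists (T y); split=> //; rewrite ?rT// -linearB rT.
Qed.

Lemma super_Delta_swap (X Y : completeNormedModType (scalars R k))
    (N : absolute_norm R) (p : absolute_sum N X Y) :
  super_Delta_point p -> super_Delta_point (absolute_sum_swap p).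
Proof. exact: super_Delta_isometry. Qed.

(** Since [b < 1], points [(u, v)] of the ball that are weakly close to
    [(a x, b y)] and almost at distance [2] from it satisfy [`|u| <= a + D] and
    [2 a - 3 D <= `|a x - u|] for a prescribed [D]; then [u] divided by
    [Num.max a `|u|] shows that [x] is a super Delta-point. *)
Lemma super_Delta_fst (X Y : completeNormedModType (scalars R k))
    (N : absolute_norm R) (x : X) (y : Y) (a b : R) :
  unit_sphere X x -> unit_sphere Y y -> 0 <= a -> 0 <= b -> N a b = 1 ->
  super_Delta_point
    ((of_real k a *: x, of_real k b *: y) : absolute_sum N X Y) ->
  b <> 1 -> super_Delta_point x.
Proof.
move=> /unit_sphereE x1 /unit_sphereE y1 a_ge0 b0 Nab /super_DeltaP[_ xyW] bn1.
have b1 : b < 1.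
  rewrite lt_neqAle; apply/andP; split; first exact/eqP.
  by rewrite -Nab absolute_norm_ge_r.
have a0 : 0 < a.
  rewrite lt_neqAle a_ge0 andbT; apply/eqP => a0.
  by move: Nab; rewrite -a0 absolute_norm0l.
have normax : real_norm (of_real k a *: x) = a.
  by rewrite real_normZ ger0_norm// x1 mulr1.
have normby : real_norm (of_real k b *: y) = b.
  by rewrite real_normZ ger0_norm// y1 mulr1.
apply/super_DeltaP; split=> // U oU Ux e e0.
have Uaax : U (of_real k a^-1 *: (of_real k a *: x)).
  by rewrite scalerA -of_realM mulVf ?gt_eqF// of_real1 scale1r.
have [d d0 [V [oV Vax VU]]] := weakly_open_scale oU Uaax.
have dE : of_real k (real_part d) = d by rewrite real_partK// ltW.
have {}d0 : 0 < real_part d by rewrite -(ltr_of_real k) dE of_real0.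
set d' := real_part d in dE d0.
(* The first bound makes the distance at least [2 - 6 D / a >= 2 - e]; the
   second one brings the normalising scalar within [d'] of [a^-1]. *)
pose D := Num.min (e * a / 6) (d' * a ^+ 2 / 2).
have D0 : 0 < D.
  by rewrite /D lt_min !divr_gt0 ?mulr_gt0 ?exprn_gt0.
have De : 6 * D <= e * a.
  suff : D <= e * a / 6 by lra.
  by rewrite ge_min lexx.
have Dd : D < d' * a ^+ 2.
  have : D <= d' * a ^+ 2 / 2 by rewrite ge_min lexx orbT.
  have : 0 < d' * a ^+ 2 by rewrite mulr_gt0// exprn_gt0.
  lra.
have h0 : 0 < D * (1 - b) by rewrite mulr_gt0// subr_gt0.
have [V1 [oV1 V1ax V1gt]] := weakly_open_norm_gt (of_real k a *: x) h0.
have [V2 [oV2 V2by V2gt]] := weakly_open_norm_gt (of_real k b *: y) h0.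
have oW := @weakly_open_setX R k N X Y _ _ (weakly_openI oV oV1) oV2.
have [//|[u v] /= [[[Vu V1u] V2v] uv1 far]] := xyW _ oW _ _ h0.
rewrite real_norm_absolute_sum /= in uv1.
rewrite real_norm_absolute_sum /= in far.
have := V1gt u V1u; have := V2gt v V2v; rewrite normax normby => bv au.
have [||pa ra] := absolute_norm_near_extremal a0 b0 b1 Nab D0
  (ltW au) (ltW bv) (real_norm_ge0 u) (real_norm_ge0 v) uv1
  (real_norm_ge0 _) _ (real_norm_ge0 _) _ far.
- by have := ler_real_normB (of_real k a *: x) u; rewrite normax.
- by have := ler_real_normB (of_real k b *: y) v; rewrite normby.
pose m := Num.max a (real_norm u).
have am : a <= m by rewrite le_max lexx.
have um : real_norm u <= m by rewrite le_max lexx orbT.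
have m0 : 0 < m by exact: lt_le_trans am.
have mD : m <= a + D by rewrite ge_max pa andbT; lra.
exists (of_real k m^-1 *: u); split.
- (* [`|a^-1 - m^-1| = (m - a) / (a m) <= D / a ^+ 2]. *)
  apply: VU => //.
  rewrite -of_realB normr_of_real -dE ltr_of_real ger0_norm; last first.
    by rewrite subr_ge0 lef_pV2.
  have -> : a^-1 - m^-1 = (m - a) / (a * m).
    by field; rewrite !gt_eqF.
  rewrite ltr_pdivrMr ?mulr_gt0//.
  apply: (@le_lt_trans _ _ D); first by lra.
  apply: (lt_le_trans Dd); rewrite ler_pM2l// expr2.
  by rewrite ler_pM2l.
- rewrite real_normZ gtr0_norm ?invr_gt0//.
  by rewrite ler_pdivrMl// mulr1.
- have mxu : m * real_norm (x - of_real k m^-1 *: u) =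
      real_norm (of_real k a *: x - u + of_real k (m - a) *: x).
    rewrite -{1}(ger0_norm (ltW m0)) -real_normZ; congr real_norm.
    rewrite scalerBr scalerA -of_realM mulfV ?gt_eqF// of_real1 scale1r.
    by rewrite addrAC -scalerDl -of_realD [a + _]addrC subrK.
  have tri : real_norm (of_real k a *: x - u) <=
      real_norm (of_real k a *: x - u + of_real k (m - a) *: x) + (m - a).
    have := ler_real_normB (of_real k a *: x - u + of_real k (m - a) *: x)
      (of_real k (m - a) *: x).
    by rewrite addrK real_normZ x1 mulr1 ger0_norm// subr_ge0.
  rewrite -mxu in tri.
  rewrite -(ler_pM2l m0).
  have : e * a <= e * m by rewrite ler_pM2l.
  lra.
Qed.

End super_Delta.

Theorem theorem1 (R : realType) (k : scalar_kind)
    (X Y : completeNormedModType (scalars R k)) (N : absolute_norm R)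
    (x : X) (y : Y) (a b : R)
    (hx : unit_sphere X x) (hy : unit_sphere Y y)
    (ha : 0 <= a) (hb : 0 <= b) (hab : N a b = 1)
    (hxy : super_Delta_point
      ((of_real k a *: x, of_real k b *: y) : absolute_sum N X Y)) :
  [/\ b <> 1 -> super_Delta_point x,
      a <> 1 -> super_Delta_point y &
      a = 1 -> b = 1 -> super_Delta_point x \/ super_Delta_point y].
Proof.
split.
- exact: super_Delta_fst hxy.
- exact: (@super_Delta_fst R k Y X (absolute_norm_swap N) y x b a
    hy hx hb ha hab (super_Delta_swap hxy)).
- move=> a1 b1; subst a b.
  rewrite of_real1 !scale1r in hxy; move: hxy => /super_DeltaP[_ xyW].
  apply: contrapT => /not_orP[nx ny].
  have [U [oU Ux [e e0 Ue]]] := not_super_DeltaP hx nx.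
  have [V [oV Vy [d d0 Vd]]] := not_super_DeltaP hy ny.
  have oW := @weakly_open_setX R k N X Y _ _ oU oV.
  have ed0 : 0 < Num.min e d by rewrite lt_min e0.
  have [//|[u v] /= [[Uu Vv] uv1 far]] := xyW _ oW _ _ ed0.
  rewrite real_norm_absolute_sum /= in uv1.
  rewrite real_norm_absolute_sum /= in far.
  have u1 : real_norm u <= 1.
    by apply: le_trans uv1; apply: absolute_norm_ge_l; exact: real_norm_ge0.
  have v1 : real_norm v <= 1.
    by apply: le_trans uv1; apply: absolute_norm_ge_r; exact: real_norm_ge0.
  have := Ue u Uu u1; have := Vd v Vv v1.
  have := absolute_norm_le_max hab
    (real_norm_ge0 (x - u)) (real_norm_ge0 (y - v)).
  have me : Num.min e d <= e by rewrite ge_min lexx.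
  have md : Num.min e d <= d by rewrite ge_min lexx orbT.
  move=> /(le_trans far); rewrite le_max => /orP[]; lra.
Qed.
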